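(* For any melody $\mathbf{x}$, we have $s(M(\mathbf{x}^i))=s(M(\mathbf{x}))$, where $\mathbf{x}^i$ denotes the inversion of $\mathbf{x}$.
   Context: A melody is a finite sequence of integers $\mathbf{x}=(x_1,\dots,x_{n+1})$. Its M-graph $M(\mathbf{x})$ is the directed graph whose vertices are the sequence of points $p_j=(x_j,x_{j+1})\in\mathbb{R}^2$, $1\leq j\leq n$, and whose edges are $(p_j,p_{j+1})$, $1\leq j\leq n-1$. The slope $s(M(\mathbf{x}))$ is the slope of the line fitted to the points $p_1,\dots,p_n$ by the method of least squares; for points $(x_1,y_1),\dots,(x_N,y_N)$ in $\mathbb{R}^2$ this slope is given by $\dfrac{N\sum_{j=1}^N x_jy_j-\sum_{j=1}^N x_j\sum_{j=1}^N y_j}{N\sum_{j=1}^N x_j^2-\left(\sum_{j=1}^N x_j\right)^2}$, applied here with $N=n$ and $y_j=x_{j+1}$. The inversion of $\mathbf{x}$ is $\mathbf{x}^i=(-x_1,\dots,-x_{n+1})$ (the superscript $i$ is a symbol standing for ''inversion'', not an index). *)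

(* Defs.v *)
From mathcomp Require Import all_boot all_order all_algebra.
From mathcomp Require Import reals.
From mathcomp Require Import ring lra.

Set Implicit Arguments.
Unset Strict Implicit.
Unset Printing Implicit Defensive.

Import Order.TTheory GRing.Theory Num.Theory.
Local Open Scope ring_scope.

(* The melody (x_1, ..., x_{n+1}); the 1-based x_j is [nth 0 x j.-1]. *)
Notation melody n := (n.+1.-tuple int).

Definition inversion (n : nat) (x : melody n) : melody n :=
  [tuple of [seq - a | a <- x]].

(* Vertices and edges are sequences, so repeated points count with their
   multiplicity. *)
Record seq_digraph (T : Type) := SeqDigraph {
  vertices : seq T;
  edges : seq (T * T)
}.

(* [:: (s_1, s_2); (s_2, s_3); ...; (s_{k-1}, s_k)], where k = size s. *)
Definition consecutive (T : Type) (s : seq T) : seq (T * T) :=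
  zip s (behead s).

Definition Mgraph (R : realType) (n : nat) (x : melody n) :
    seq_digraph (R * R) :=
  let p : seq (R * R) := consecutive [seq a%:~R | a <- x] in
  SeqDigraph p (consecutive p).

Section LeastSquares.
Variable R : realType.
Implicit Types (s : seq (R * R)) (a b : R).

Definition lsq_num s : R :=
  (size s)%:R * (\sum_(p <- s) p.1 * p.2)
  - (\sum_(p <- s) p.1) * (\sum_(p <- s) p.2).

Definition lsq_den s : R :=
  (size s)%:R * (\sum_(p <- s) p.1 ^+ 2) - (\sum_(p <- s) p.1) ^+ 2.

(* [None] when the denominator vanishes, i.e. when s is empty or all its points
   lie on a vertical line: the fitted slope is then undefined. *)
Definition lsq_slope s : option R :=
  if lsq_den s == 0 then None else Some (lsq_num s / lsq_den s).

Definition sq_error s a b : R := \sum_(p <- s) (p.2 - (a * p.1 + b)) ^+ 2.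

Definition lsq_line s a b : Prop :=
  forall a' b', sq_error s a b <= sq_error s a' b'.

Lemma sq_errorE s a b :
  (size s)%:R * sq_error s a b =
    ((size s)%:R * b - \sum_(p <- s) p.2 + a * \sum_(p <- s) p.1) ^+ 2
    + a ^+ 2 * lsq_den s - 2 * a * lsq_num s
    + ((size s)%:R * (\sum_(p <- s) p.2 ^+ 2) - (\sum_(p <- s) p.2) ^+ 2).
Proof.
have -> : sq_error s a b =
    (\sum_(p <- s) p.2 ^+ 2) - 2 * a * (\sum_(p <- s) p.1 * p.2)
    - 2 * b * (\sum_(p <- s) p.2) + a ^+ 2 * (\sum_(p <- s) p.1 ^+ 2)
    + 2 * a * b * (\sum_(p <- s) p.1) + (size s)%:R * b ^+ 2.
  rewrite /sq_error; elim: s => [|p s IHs]; first by rewrite !big_nil /=; ring.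
  by rewrite !big_cons IHs /= -natr1; ring.
by rewrite /lsq_den /lsq_num; ring.
Qed.

Lemma lsq_den_ge0 s : 0 <= lsq_den s.
Proof.
have [/size0nil ->|s_gt0] := posnP (size s).
  by rewrite /lsq_den !big_nil /= mul0r expr0n subr0.
have N_gt0 : 0 < (size s)%:R :> R by rewrite ltr0n.
rewrite -(pmulr_rge0 _ N_gt0).
suff H (c d : R) : \sum_(p <- s) (c * p.1 - d) ^+ 2 =
    c ^+ 2 * (\sum_(p <- s) p.1 ^+ 2) - 2 * c * d * (\sum_(p <- s) p.1)
    + (size s)%:R * d ^+ 2.
  have -> : (size s)%:R * lsq_den s =
      \sum_(p <- s) ((size s)%:R * p.1 - \sum_(p <- s) p.1) ^+ 2.
    by rewrite H /lsq_den; ring.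
  by apply: sumr_ge0 => p _; exact: sqr_ge0.
elim: (s) => [|p s' IHs]; first by rewrite !big_nil /=; ring.
by rewrite !big_cons IHs /= -natr1; ring.
Qed.

(* [lsq_slope] is the slope of the lines y = a x + b minimising the sum of
   squared errors, whenever that slope is unique. *)
Lemma lsq_slopeP s a :
  lsq_slope s = Some a <->
  (exists b, lsq_line s a b) /\ (forall a' b', lsq_line s a' b' -> a' = a).
Proof.
rewrite /lsq_slope.
have [/size0nil ->|s_gt0] := posnP (size s).
  rewrite /lsq_den !big_nil /= mul0r expr0n subr0 eqxx; split=> // -[_ H].
  have l1 : lsq_line [::] (a + 1) 0.
    by move=> a' b'; rewrite /sq_error !big_nil.
  by exfalso; have := H _ _ l1; lra.
have N_gt0 : 0 < (size s)%:R :> R by rewrite ltr0n.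
have N_neq0 := lt0r_neq0 N_gt0.
have lineE a1 b1 a2 b2 : (sq_error s a1 b1 <= sq_error s a2 b2) =
    ((size s)%:R * sq_error s a1 b1 <= (size s)%:R * sq_error s a2 b2).
  by rewrite ler_pM2l.
set X := \sum_(p <- s) p.1; set Y := \sum_(p <- s) p.2.
have [D0|D_neq0] := eqVneq (lsq_den s) 0.
  split=> // -[[b lb] uniq].
  have l1 e : (size s)%:R * sq_error s (a + e) (b - e * X / (size s)%:R) =
      (size s)%:R * sq_error s a b - 2 * e * lsq_num s.
    by rewrite !sq_errorE D0 -/X -/Y; field.
  have [E0|E0] := leP 0 (lsq_num s).
    have l2 : lsq_line s (a + 1) (b - 1 * X / (size s)%:R).
      move=> a' b'; apply: le_trans (lb a' b').
      by rewrite lineE l1; lra.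
    by exfalso; have := uniq _ _ l2; lra.
  have l2 : lsq_line s (a + -1) (b - -1 * X / (size s)%:R).
    move=> a' b'; apply: le_trans (lb a' b').
    by rewrite lineE l1; lra.
  by exfalso; have := uniq _ _ l2; lra.
have D_gt0 : 0 < lsq_den s by rewrite lt_def D_neq0 lsq_den_ge0.
pose a0 := lsq_num s / lsq_den s.
pose b0 := (Y - a0 * X) / (size s)%:R.
have gap a' b' : (size s)%:R * sq_error s a' b' =
    (size s)%:R * sq_error s a0 b0
    + ((size s)%:R * b' - Y + a' * X) ^+ 2 + lsq_den s * (a' - a0) ^+ 2.
  by rewrite !sq_errorE -/X -/Y /b0 /a0; field; rewrite N_neq0 D_neq0.
have line0 : lsq_line s a0 b0.
  move=> a' b'; rewrite lineE [leRHS]gap -[leRHS]addrA lerDl.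
  apply: addr_ge0; first exact: sqr_ge0.
  by apply: mulr_ge0; [exact: lsq_den_ge0 | exact: sqr_ge0].
have uniq0 a' b' : lsq_line s a' b' -> a' = a0.
  move=> /(_ a0 b0); rewrite lineE [leLHS]gap -[leLHS]addrA gerDl => H.
  have : lsq_den s * (a' - a0) ^+ 2 <= 0.
    by apply: le_trans H; rewrite lerDr sqr_ge0.
  rewrite pmulr_rle0 // => H2.
  by apply/eqP; rewrite -subr_eq0 -sqrf_eq0 eq_le H2 sqr_ge0.
split=> [[<-]|[[b lb] _]].
  by split; [exists b0 | exact: uniq0].
by rewrite (uniq0 _ _ lb).
Qed.

End LeastSquares.

Definition slope (R : realType) (G : seq_digraph (R * R)) : option R :=
  lsq_slope (vertices G).

(* Main.v *)
Require Import Defs.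
From mathcomp Require Import all_boot all_order all_algebra.
From mathcomp Require Import reals.

Import GRing.Theory.

(** Inversion turns the vertices by a half-turn about the origin. Numerator and denominator of the
    slope are quadratic in the coordinates, so the signs cancel ([lsq_slope_opp]), also when the
    slope is [None]. *)

Lemma consecutive_map (T U : Type) (f : T -> U) (s : seq T) :
  consecutive [seq f a | a <- s] =
  [seq (f p.1, f p.2) | p <- consecutive s].
Proof.
rewrite /consecutive behead_map.
(* The induction needs an arbitrary second list in place of [behead s]. *)
by elim: s (behead s) => [|a s IHs] [|b t] //=; rewrite IHs.
Qed.

Lemma lsq_slope_opp (R : realType) (s : seq (R * R)) :
  lsq_slope [seq (- p.1, - p.2)%R | p <- s] = lsq_slope s.
Proof.
rewrite /lsq_slope /lsq_den /lsq_num size_map !big_map /= !sumrN sqrrN mulrNN.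
rewrite (eq_bigr _ (fun p _ => sqrrN p.1)).
by rewrite (eq_bigr _ (fun p _ => mulrNN p.1 p.2)).
Qed.

Theorem proposition1p3 (R : realType) (n : nat) (x : melody n) :
  slope (Mgraph R (inversion x)) = slope (Mgraph R x).
Proof.
(* The half-turn, inserted on the right, is pulled back to a negation of the notes cast into [R]. *)
rewrite /slope /= -[RHS]lsq_slope_opp -consecutive_map -!map_comp.
by congr (lsq_slope (consecutive _)); apply: eq_map => a /=; rewrite mulrNz.
Qed.
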